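(* For each $\epsilon>0$ there exist an infinite subsequence $\omega=(p_{b_j})_{j\ge1}$ ($b_1<b_2<\cdots$) of $p_0,p_1,p_2,\dots$ and a positive integer $K_0'$ such that $t_N(\omega)<K_0'$ for all $N\in\mathbb{Z}_{\ge0}$ and $b_j\ll j^{2+\epsilon}$ (i.e. $b_j\le C j^{2+\epsilon}$ for some constant $C$ and all $j$).
   Context: Let $q=p^s$ be a prime power and $\mathbb{F}_q$ the field with $q$ elements. Fix a bijection $\iota:\{0,1,\dots,q-1\}\to\mathbb{F}_q$ with $\iota(0)=0$. For $N\in\mathbb{Z}_{\ge0}$ with base-$q$ expansion $N=c_0+c_1q+\dots+c_nq^n$ ($0\le c_i<q$), put $p_N=\iota(c_0)+\iota(c_1)T+\dots+\iota(c_n)T^n\in\mathbb{F}_q[T]$; this gives a bijection $\mathbb{Z}_{\ge0}\to\mathbb{F}_q[T]$. For a subsequence $\omega$ of $p_0,p_1,\dots$ write $f\in\omega$ if $f$ occurs in $\omega$, and for $N\ge0$ define $t_N(\omega)=|\{(a,b)\in\mathbb{Z}_{\ge0}^2: p_a,p_b\in\omega,\ p_N=p_a-p_b,\ \deg p_a,\deg p_b\le\deg p_N\}|$, with $\deg 0=-\infty$. *)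

(* Defs.v *)
From HB Require Import structures.
From mathcomp Require Import all_boot all_order all_algebra.
From mathcomp Require Import finmap.
From mathcomp Require Import all_classical all_reals all_analysis.

Set Implicit Arguments.
Unset Strict Implicit.
Unset Printing Implicit Defensive.

Import Order.TTheory GRing.Theory Num.Theory.
Local Open Scope classical_set_scope.
Local Open Scope ring_scope.

Lemma card_finField_gt0 (F : finFieldType) : (0 < #|F|)%N.
Proof. by apply/card_gt0P; exists 0. Qed.

(* With q = #|F|, the coefficient c_i of q ^ i in the base-q expansion of N. *)
Definition digit (F : finFieldType) (N i : nat) : 'I_#|F| :=
  Ordinal (ltn_pmod (N %/ #|F| ^ i) (card_finField_gt0 F)).

(* trunc_log q N is the position of the leading base-q digit of N (and 0 for
   N = 0). *)
Definition polyN (F : finFieldType) (iota : 'I_#|F| -> F) (N : nat) :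
    {poly F} :=
  \poly_(i < (trunc_log #|F| N).+1) iota (digit F N i).

(* As size f = deg f + 1 for f != 0 and size 0 = 0, comparing sizes is the same
   as comparing degrees with deg 0 = -oo. *)
Definition diff_pairs (F : finFieldType) (iota : 'I_#|F| -> F)
    (omega : set {poly F}) (N : nat) : set (nat * nat) :=
  [set ab : nat * nat |
    [/\ omega (polyN iota ab.1), omega (polyN iota ab.2),
        polyN iota N = polyN iota ab.1 - polyN iota ab.2,
        (size (polyN iota ab.1) <= size (polyN iota N))%N
      & (size (polyN iota ab.2) <= size (polyN iota N))%N]].

(* fset_set returns the empty set on infinite sets; this never happens here, see
   finite_diff_pairs. *)
Definition tN (F : finFieldType) (iota : 'I_#|F| -> F)
    (omega : set {poly F}) (N : nat) : nat :=
  #|` fset_set (diff_pairs iota omega N)|%fset.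

Lemma ltn_exp_size_polyN (F : finFieldType) (iota : 'I_#|F| -> F) (a : nat) :
  injective iota -> iota (Ordinal (card_finField_gt0 F)) = 0 ->
  (a < #|F| ^ size (polyN iota a))%N.
Proof.
move=> iota_inj iota0; have q_gt1 : (1 < #|F|)%N by exact: card_finNzRing_gt1.
have [->|a_gt0] := posnP a; first by rewrite expn_gt0 card_finField_gt0.
apply: (leq_trans (trunc_log_ltn a q_gt1)); rewrite leq_exp2l//.
set m := trunc_log _ _; rewrite ltnNge; apply/negP => size_le.
have := coef_poly m.+1 (fun i => iota (digit F a i)) m.
rewrite ltnSn -/(polyN iota a) nth_default// -iota0 => /iota_inj/(congr1 val)/=.
have le_a : (#|F| ^ m <= a)%N by exact: trunc_logP.
rewrite modn_small; last first.
  by rewrite ltn_divLR ?expn_gt0 ?card_finField_gt0// -expnS trunc_log_ltn.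
by apply/eqP; rewrite eq_sym -lt0n divn_gt0 ?expn_gt0 ?card_finField_gt0.
Qed.

Lemma finite_diff_pairs (F : finFieldType) (iota : 'I_#|F| -> F)
    (omega : set {poly F}) (N : nat) :
  injective iota -> iota (Ordinal (card_finField_gt0 F)) = 0 ->
  finite_set (diff_pairs iota omega N).
Proof.
move=> iota_inj iota0; set M := (#|F| ^ size (polyN iota N))%N.
have bound a : (size (polyN iota a) <= size (polyN iota N))%N -> (a < M)%N.
  move=> le_size; apply: leq_trans (ltn_exp_size_polyN a iota_inj iota0) _.
  by rewrite leq_pexp2l ?card_finField_gt0.
apply: (@sub_finite_set _ _ (`I_M `*` `I_M)); last first.
  by apply: finite_setX; exact: finite_II.
by move=> [a b] [_ _ _ /= /bound a_lt /bound b_lt].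
Qed.

(* Main.v *)
(* Put in omega, for a sparse sequence of degrees 2 m_k, all the polynomials
   T^(2 m_k) + u M_k with deg u < m_k, where deg M_k = m_k. There are q^(m_k) of
   them, and m_(k+1) <= (1 + 1/s) m_k, so b_j << j^(2 + 2/s).
   If p_N = f - g is counted by t_N, then f and g have different degrees, the
   larger one being deg p_N = 2 m_k. Two such representations with f, f' of
   level k satisfy f - f' = g - g', and M_k divides f - f'. If g and g' both have
   degree < m_k, then f = f'. Only the levels j < k with 2 m_j >= m_k remain,
   fewer than L of them as m grows geometrically. For each one there is at most
   one representation when M_j and M_k are coprime, as M_k then divides
   (g - g') / M_j, of degree < m_j < m_k. So it is enough that any L consecutive
   M_k be pairwise coprime: take powers of L pairwise coprime polynomials. *)

Require Import Defs.
From HB Require Import structures.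
From mathcomp Require Import all_boot all_order all_algebra.
From mathcomp Require Import finmap zify.
From mathcomp Require Import all_classical all_reals all_analysis.

Import Order.TTheory GRing.Theory Num.Theory.
Local Open Scope classical_set_scope.
Local Open Scope ring_scope.

Set Implicit Arguments.
Unset Strict Implicit.

(** * Enumerations and slowly growing sequences of integers *)

Section Enumeration.
Local Open Scope nat_scope.

(** [b j] is the least n such that more than j elements of [B] are at most n. The last clause serves
    to turn lower bounds on counts into upper bounds on [b]. *)
Lemma nat_enumeration (B : pred nat) :
    (forall j, exists n, j < count B (iota 0 n)) ->
  exists b : nat -> nat,
    [/\ {homo b : i j / i < j}, forall j, B (b j)
      & forall j n, j < count B (iota 0 n) -> b j < n].
Proof.
move=> Binf.
have cntS n : count B (iota 0 n.+1) = count B (iota 0 n) + B n.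
  by rewrite -addn1 iotaD count_cat /= add0n addn0.
have exb j : exists n, j < count B (iota 0 n.+1).
  by have [n hn] := Binf j; exists n; rewrite cntS ltn_addr.
pose b j := ex_minn (exb j).
have ltb j : j < count B (iota 0 (b j).+1) by rewrite /b; case: ex_minnP.
have bmin j n : j < count B (iota 0 n) -> b j < n.
  by case: n => // n; rewrite /b; case: ex_minnP => x _ /(_ n).
have leb j : count B (iota 0 (b j)) <= j.
  by rewrite leqNgt; apply/negP => /bmin; rewrite ltnn.
exists b; split=> // [i j ltij|j].
  rewrite ltnNge; apply/negP => leji.
  have : count B (iota 0 (b j).+1) <= count B (iota 0 (b i).+1).
    by rewrite -(subnKC leji) -addSn iotaD count_cat leq_addr.
  by have := ltb j; have := leb i; rewrite (cntS (b i)); case: (B (b i)); lia.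
by have := leq_ltn_trans (leb j) (ltb j); rewrite cntS; case: (B (b j)); lia.
Qed.

(** Take e_(k+1) = e_k + floor(e_k / s). Starting at s keeps every increment positive. From index i
    on each increment is at least floor(e_i / s) > e_i / (2s), so 2s + 1 steps more than double
    e_i. *)
Lemma slow_sequence (s : nat) : 0 < s ->
  exists e : nat -> nat,
    [/\ forall k, 0 < e k, {homo e : i j / i < j},
        forall k, s * e k.+1 <= s.+1 * e k
      & forall i j, i + s.*2.+1 <= j -> (e i).*2 < e j].
Proof.
move=> s_gt0; pose e k := iter k (fun x => x + x %/ s) s.
have le_s k : s <= e k.
  by elim: k => //= k IHk; exact: leq_trans IHk (leq_addr _ _).
have e_mono : {homo e : i j / i < j}.
  apply: homo_ltn => [x y z|]; first exact: ltn_trans.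
  by move=> k; rewrite /e /= -/(e k) -addn1 leq_add2l divn_gt0.
exists e; split=> // [k|k|i j].
- exact: leq_trans (le_s k).
- by rewrite /e /= -/(e k); have := leq_divM (e k) s; lia.
have le_e : {homo e : i j / i <= j} by exact: ltnW_homo e_mono.
have step n : e i + n * (e i %/ s) <= e (i + n).
  elim: n => [|n IHn]; first by rewrite mul0n !addn0.
  rewrite addnS /e /= -/(e (i + n)).
  by rewrite mulSn addnCA addnC leq_add // leq_div2r // le_e // leq_addr.
move=> /le_e/(leq_trans (step _)) le_ej.
have := ltn_ceil (e i) s_gt0; have : 0 < e i %/ s by rewrite divn_gt0.
nia.
Qed.

End Enumeration.

(** * Coprime polynomials of prescribed degrees *)

Section Coprime.
Variable F : fieldType.

(* Sylvester's sequence: [sylvester n + 1] divides [sylvester n.+1]. *)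
Fixpoint sylvester (n : nat) : {poly F} :=
  if n is n'.+1 then sylvester n' * (sylvester n' + 1) else 'X.

Lemma size_sylvester n : size (sylvester n) = (2 ^ n).+1.
Proof.
elim: n => [|n IHn]; first by rewrite size_polyX.
have sz1 : size (sylvester n + 1) = (2 ^ n).+1.
  by rewrite size_polyDl IHn // size_poly1 ltnS expn_gt0.
rewrite /= size_mul -?size_poly_eq0 ?sz1 ?IHn // expnS; lia.
Qed.

Lemma size_sylvesterD1 n : size (sylvester n + 1) = (2 ^ n).+1.
Proof.
by rewrite size_polyDl size_sylvester // size_poly1 ltnS expn_gt0.
Qed.

Lemma dvdp_sylvester i j : (i < j)%N -> sylvester i + 1 %| sylvester j.
Proof.
elim: j => // j IHj; rewrite ltnS leq_eqVlt => /orP[/eqP->|/IHj dvd_ij] /=.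
  exact: dvdp_mull.
exact: dvdp_mulr.
Qed.

(** For i < j, [sylvester j + 1] is 1 modulo [sylvester i + 1]. *)
Lemma coprimep_sylvester i j :
  i != j -> coprimep (sylvester i + 1) (sylvester j + 1).
Proof.
wlog ltij : i j / (i < j)%N => [hwlog|_].
  move=> neij; case: (ltngtP i j) => [ltij|ltji|eqij].
  - exact: hwlog.
  - by rewrite coprimep_sym hwlog // eq_sym.
  - by rewrite eqij eqxx in neij.
have /dvdpP[r ->] := dvdp_sylvester ltij.
by rewrite coprimep_addl_mul coprimep1.
Qed.

(** With r = k mod L, [M k] is a power of [sylvester r + 1], of degree 2^r; the factor 2^L in [m k]
    makes 2^r divide it. Indices less than L apart have distinct residues. *)
Lemma coprime_moduli (s : nat) : (0 < s)%N ->
  exists (L : nat) (m : nat -> nat) (M : nat -> {poly F}),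
    [/\ forall k, size (M k) = (m k).+1,
        {homo m : i j / (i < j)%N},
        forall k, (s * m k.+1 <= s.+1 * m k)%N,
        forall i j, (i + L <= j)%N -> ((m i).*2 < m j)%N
      & forall i j, (i < j < i + L)%N -> coprimep (M i) (M j)].
Proof.
move=> s_gt0; have [e [e_gt0 e_mono e_slow e_double]] := slow_sequence s_gt0.
pose L := s.*2.+1; exists L, (fun k => 2 ^ L * e k)%N.
exists (fun k => (sylvester (k %% L) + 1) ^+ (2 ^ (L - k %% L) * e k)).
split=> [k|i j ltij|k|i j leij|i j /andP[ltij ltji]].
- set p := _ + 1; have lek : (k %% L <= L)%N by rewrite ltnW // ltn_pmod.
  have szp : size p = (2 ^ (k %% L)).+1 := size_sylvesterD1 _.
  have sz_gt0 : (0 < size (p ^+ (2 ^ (L - k %% L) * e k)))%N.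
    by rewrite size_poly_gt0 expf_neq0 // -size_poly_eq0 szp.
  by rewrite -(prednK sz_gt0) size_exp szp /= mulnA -expnD subnKC.
- by rewrite ltn_pmul2l ?expn_gt0 // e_mono.
- by rewrite mulnCA [leqRHS]mulnCA leq_pmul2l ?expn_gt0.
- by rewrite doubleMr ltn_pmul2l ?expn_gt0 // e_double.
apply/coprimep_expl/coprimep_expr/coprimep_sylvester/eqP => eq_mod.
have /eqP : j = i %[mod L] by [].
rewrite eqn_mod_dvd ?(ltnW ltij) // => /dvdn_leq.
by rewrite subn_gt0 ltij => /(_ isT); lia.
Qed.

End Coprime.

(** * The base-q bijection between integers and polynomials *)

Section PolyN.
Variables (F : finFieldType) (iota : 'I_#|F| -> F).
Hypothesis iota_bij : bijective iota.
Hypothesis iota0 : iota (Ordinal (card_finField_gt0 F)) = 0.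

Let q_gt1 : (1 < #|F|)%N. Proof. exact: card_finNzRing_gt1. Qed.
Let q_gt0 : (0 < #|F|)%N. Proof. exact: ltnW. Qed.

Lemma coef_polyN a i : (polyN iota a)`_i = iota (digit F a i).
Proof.
rewrite /polyN coef_poly; case: ltnP => // lti.
rewrite -[LHS]iota0; congr iota; apply: val_inj => /=.
rewrite divn_small ?mod0n //; apply: leq_trans (trunc_log_ltn a q_gt1) _.
by rewrite leq_exp2l.
Qed.

Lemma polyN_inj : injective (polyN iota).
Proof.
move=> a b /polyP eq_ab.
have eq_dig i : (a %/ #|F| ^ i = b %/ #|F| ^ i %[mod #|F|])%N.
  have := eq_ab i; rewrite !coef_polyN => /(bij_inj iota_bij).
  by move=> /(congr1 val).
have main n x y : (x < #|F| ^ n)%N -> (y < #|F| ^ n)%N ->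
    (forall i, x %/ #|F| ^ i = y %/ #|F| ^ i %[mod #|F|])%N -> x = y.
  elim: n x y => [|n IHn] x y; first by case: x y => [|?] [|?].
  rewrite expnSr -!ltn_divLR // => ltx lty eq_xy.
  rewrite (divn_eq x #|F|) (divn_eq y #|F|); have := eq_xy 0%N.
  rewrite expn0 !divn1 => ->; congr (_ * _ + _)%N.
  by apply: IHn => // i; rewrite -!divnMA -expnS.
apply: (main (maxn a b)) => //; apply: leq_trans (ltn_expl _ q_gt1) _.
  by rewrite leq_exp2l // leq_maxl.
by rewrite leq_exp2l // leq_maxr.
Qed.

Lemma polyN_surj n (f : {poly F}) : (size f <= n)%N ->
  exists2 a, (a < #|F| ^ n)%N & polyN iota a = f.
Proof.
have [iotaV _ iotaVK] := iota_bij.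
elim: n f => [|n IHn] f le_f.
  move: le_f; rewrite leqn0 size_poly_eq0 => /eqP->; exists 0%N => //.
  by apply/polyP => i; rewrite coef_polyN coef0 -iota0; congr iota;
    apply: val_inj; rewrite /= div0n mod0n.
have [] := IHn (drop_poly 1 f); first by rewrite size_drop_poly; lia.
move=> a lta /polyP eq_a; pose c := iotaV f`_0.
(* The constant coefficient gives the last digit, the shifted polynomial the remaining ones. *)
exists (a * #|F| + c)%N.
  have := ltn_ord c; rewrite expnSr.
  have : (a.+1 * #|F| <= #|F| ^ n * #|F|)%N by rewrite leq_mul2r lta orbT.
  rewrite mulSn; lia.
apply/polyP => -[|i]; rewrite coef_polyN.
  rewrite -[RHS]iotaVK; congr iota; apply: val_inj => /=.
  by rewrite divn1 modnMDl modn_small.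
have := eq_a i; rewrite coef_polyN coef_drop_poly addn1 => <-.
congr iota; apply: val_inj => /=.
by rewrite expnS divnMA divnMDl // (divn_small (ltn_ord c)) addn0.
Qed.

Lemma size_polyN_le n a : (a < #|F| ^ n)%N -> (size (polyN iota a) <= n)%N.
Proof.
move=> lta; apply/leq_sizeP => i lei; rewrite coef_polyN -iota0.
congr iota; apply: val_inj => /=; rewrite divn_small ?mod0n //.
by apply: leq_trans lta _; rewrite leq_pexp2l.
Qed.

End PolyN.

(** Choosing a label for each element gives an injection of [D] into [I]. Labels form a relation
    because the levels behind them are only known to exist. *)
Lemma card_fset_set_labelled (T : choiceType) (I : finType) (D : set T)
    (lab : T -> I -> Prop) :
    finite_set D ->
    (forall x, D x -> exists i, lab x i) ->
    (forall x y i, D x -> D y -> lab x i -> lab y i -> x = y) ->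
  (#|` fset_set D|%fset <= #|I|)%N.
Proof.
move=> finD exlab lab_inj.
have [i0|I0] := pickP I; last first.
  suff -> : D = set0 by rewrite fset_set0 cardfs0.
  by rewrite -subset0 => x /exlab[i]; have := I0 i.
have /choice[g gP] : forall x, exists i, D x -> lab x i.
  move=> x; have [Dx|nDx] := pselect (D x); last by exists i0.
  by have [i labi] := exlab x Dx; exists i.
have inD x : x \in fset_set D -> D x by rewrite in_fset_set // inE.
have uniq_g : uniq (map g (fset_set D)).
  rewrite map_inj_in_uniq ?fset_uniq // => x y /inD Dx /inD Dy eq_g.
  by apply: (lab_inj x y (g x)) => //; [exact: gP|rewrite eq_g; exact: gP].
by rewrite -(size_map g) -(card_uniqP uniq_g) max_card.
Qed.

(** * Blocks of polynomials and their differences *)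

Section Construction.
Variables (F : finFieldType) (L : nat) (m : nat -> nat) (M : nat -> {poly F}).
Hypothesis size_M : forall k, size (M k) = (m k).+1.
Hypothesis m_mono : {homo m : i j / (i < j)%N}.
Hypothesis m_double : forall i j, (i + L <= j)%N -> ((m i).*2 < m j)%N.
Hypothesis M_coprime :
  forall i j, (i < j < i + L)%N -> coprimep (M i) (M j).

(* Within one block [M k] divides all differences, so a difference of two
   elements of block [k] that is also a difference of two shorter elements is
   killed by its degree or by coprimality with [M j]. *)
Definition block (k : nat) : set {poly F} :=
  [set 'X^((m k).*2) + u * M k | u in [set u : {poly F} | (size u <= m k)%N]].

Definition blocks : set {poly F} := \bigcup_k block k.

Lemma size_mulM k (u : {poly F}) :
  (size u <= m k)%N -> (size (u * M k)%R <= (m k).*2)%N.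
Proof.
move=> le_u; apply: leq_trans (size_polyMleq _ _) _.
by rewrite size_M addnS /= -addnn leq_add2r.
Qed.

Lemma size_block k f : block k f -> size f = (m k).*2.+1.
Proof.
move=> [u /= le_u <-]; rewrite size_polyDl size_polyXn //.
by rewrite ltnS size_mulM.
Qed.

Lemma block_sub k f f' : block k f -> block k f' ->
  exists2 w : {poly F}, (size w <= m k)%N & f - f' = w * M k.
Proof.
move=> [u /= le_u <-] [u' /= le_u' <-]; exists (u - u'); last first.
  by rewrite opprD addrACA subrr add0r mulrBl.
by rewrite (leq_trans (size_polyD _ _)) // size_polyN geq_max le_u.
Qed.

Lemma size_block_sub j k f g : (j < k)%N -> block k f -> block j g ->
  size (f - g) = (m k).*2.+1.
Proof.
move=> ltjk /size_block szf /size_block szg.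
by rewrite size_polyDl szf // size_polyN szg ltnS ltn_double m_mono.
Qed.

(** Equality of the capped gaps means that j = j' or that both levels lie at least L below k. *)
Lemma block_sub_eq k j j' f f' g g' :
    block k f -> block k f' -> block j g -> block j' g' ->
    (j < k)%N -> (j' < k)%N -> minn (k - j) L = minn (k - j') L ->
  f - f' = g - g' -> f = f' /\ g = g'.
Proof.
move=> kf kf' jg j'g' ltjk ltj'k eq_min eq_fg.
suff eq0 : f - f' = 0.
  by split; apply/eqP; rewrite -subr_eq0 -?eq_fg eq0.
have [w le_w eq_f] := block_sub kf kf'.
have M_neq0 i : M i != 0 by rewrite -size_poly_eq0 size_M.
(* For [L <= k - j] every nonzero multiple of [M k] outsizes [g - g']. *)
have [leL|ltL] := leqP L (k - j).
  have leL' : (L <= k - j')%N by lia.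
  have ltm : ((m j).*2 < m k)%N by apply: m_double; lia.
  have ltm' : ((m j').*2 < m k)%N by apply: m_double; lia.
  have : (size (w * M k)%R <= m k)%N.
    rewrite -eq_f eq_fg (leq_trans (size_polyD _ _)) // size_polyN.
    by rewrite (size_block jg) (size_block j'g') geq_max ltm.
  rewrite eq_f; have [->|w_neq0] := eqVneq w 0; first by rewrite mul0r.
  rewrite size_mul // size_M addnS /= -[leqRHS]add0n leq_add2r.
  by rewrite leqn0 size_poly_eq0 (negPf w_neq0).
have eq_j : j' = j by lia.
rewrite eq_j in j'g'.
have [v le_v eq_g] := block_sub jg j'g'.
(* The gap is now below L, so [M k] is coprime to [M j] and divides v, whose degree is less than m_j
   < m_k. *)
have /dvdp_leq : M k %| v.
  rewrite -(@Gauss_dvdpl _ v (M j)); last first.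
    by rewrite coprimep_sym; apply: M_coprime; lia.
  by rewrite -eq_g -eq_fg eq_f dvdp_mull.
rewrite eq_fg eq_g; have [->|v_neq0] := eqVneq v 0; first by rewrite mul0r.
move=> /(_ isT); rewrite size_M => /leq_trans/(_ le_v)/ltn_trans.
by move=> /(_ _ (m_mono ltjk)); rewrite ltnn.
Qed.

(** * Bounds on t_N and on the growth of the indices *)

Section Iota.
Variable iota : 'I_#|F| -> F.
Hypothesis iota_bij : bijective iota.
Hypothesis iota0 : iota (Ordinal (card_finField_gt0 F)) = 0.

Lemma tN_blocks_le (omega : set {poly F}) N :
  omega `<=` blocks -> (tN iota omega N <= #|{: bool * 'I_L.+1}|)%N.
Proof.
move=> sub_omega.
pose big (ab : nat * nat) (c : bool) := if c then ab.1 else ab.2.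
(* The level k is forced by deg (p_N); the label records which entry has the
   larger degree and how far, up to L, the level of the other one lies below. *)
pose lab (ab : nat * nat) (c : bool * 'I_L.+1) := exists k j,
  [/\ (j < k)%N, block k (polyN iota (big ab c.1)),
      block j (polyN iota (big ab (~~ c.1))) & c.2 = minn (k - j) L :> nat].
apply: (@card_fset_set_labelled _ _ _ lab).
- exact/finite_diff_pairs/iota0/bij_inj.
- move=> [a b] [/sub_omega[i _ ia] /sub_omega[j _ jb] eqN /= leN _].
  case: (ltngtP i j) => [ltij|ltji|eqij].
  + exists (false, inord (minn (j - i) L)), j, i; split=> //=.
    by rewrite inordK // ltnS geq_minr.
  + exists (true, inord (minn (i - j) L)), i, j; split=> //=.
    by rewrite inordK // ltnS geq_minr.
  (* Within one block the leading terms cancel, against deg p_a <= deg p_N. *)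
  + rewrite -eqij in jb; have [w le_w eq_w] := block_sub ia jb.
    by move: leN; rewrite eqN eq_w (size_block ia) ltnNge size_mulM.
move=> [a b] [a' b'] [c d] [/= _ _ eqN _ _] [/= _ _ eqN' _ _].
move=> [k [j [ltjk /= kx jy eq_d]]] [k' [j' [ltj'k' /= kx' jy' eq_min]]].
rewrite eq_d in eq_min.
have szN : size (polyN iota N) = (m k).*2.+1.
  case: c kx jy {kx' jy'} => /= kx jy; rewrite eqN.
    exact: size_block_sub ltjk kx jy.
  by rewrite -size_polyN opprB; exact: size_block_sub ltjk kx jy.
have szN' : size (polyN iota N) = (m k').*2.+1.
  case: c kx' jy' {kx jy} => /= kx' jy'; rewrite eqN'.
    exact: size_block_sub ltj'k' kx' jy'.
  by rewrite -size_polyN opprB; exact: size_block_sub ltj'k' kx' jy'.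
have eq_k : k' = k.
  have : m k = m k' by lia.
  by case: (ltngtP k k') => // /m_mono; lia.
rewrite {k'}eq_k in ltj'k' kx' szN' eq_min.
have eq_ab : polyN iota a - polyN iota a' = polyN iota b - polyN iota b'.
  have /eqP : polyN iota a - polyN iota b = polyN iota a' - polyN iota b'.
    by rewrite -eqN eqN'.
  by rewrite subr_eq => /eqP->; rewrite addrC addrA addKr addrC.
have [] := block_sub_eq kx kx' jy jy' ltjk ltj'k' eq_min.
  by case: c {kx kx' jy jy'}.
by case: c {kx kx' jy jy'} => /= /(polyN_inj iota_bij iota0)->
  /(polyN_inj iota_bij iota0)->.
Qed.

(** Block k alone suffices: v < q^(m_k) gives distinct elements, all of degree 2 m_k and hence of
    index below q^(2 m_k + 1). *)
Lemma count_blocks k :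
  (#|F| ^ m k <= count (fun a => `[< blocks (polyN iota a) >])
                       (seq.iota 0 (#|F| ^ (m k).*2.+1)))%N.
Proof.
pose f v := 'X^((m k).*2) + polyN iota v * M k.
have fP v : (v < #|F| ^ m k)%N -> block k (f v).
  by move=> ltv; exists (polyN iota v) => //=; exact: size_polyN_le.
have /choice[idx idxP] : forall v, exists a, (v < #|F| ^ m k)%N ->
    (a < #|F| ^ (m k).*2.+1)%N /\ polyN iota a = f v.
  move=> v; case: ltnP => [ltv|_]; last by exists 0%N.
  have := @polyN_surj _ _ iota_bij iota0 (m k).*2.+1 (f v).
  by rewrite (size_block (fP v ltv)) leqnn => /(_ isT)[a lta eqa]; exists a.
have M_neq0 : M k != 0 by rewrite -size_poly_eq0 size_M.
rewrite -size_filter -[leqLHS](size_iota 0) -(size_map idx).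
apply: uniq_leq_size => [|a].
  rewrite map_inj_in_uniq ?iota_uniq // => v w.
  rewrite !mem_iota /= !add0n => /idxP[_ fv] /idxP[_ fw] eq_idx.
  apply: (polyN_inj iota_bij iota0); apply: (mulIf M_neq0).
  by apply: (@addrI _ 'X^((m k).*2)); rewrite -/(f v) -fv eq_idx fw.
case/mapP => v; rewrite mem_iota /= add0n => ltv ->.
have [lta eqa] := idxP v ltv.
rewrite mem_filter mem_iota /= add0n lta andbT; apply/asboolP.
by exists k => //; rewrite eqa; exact: fP.
Qed.

(** For the least k with j < q^(m_k), b_j < q^(2 m_k + 1), while q^(m_(k-1)) <= j if k > 0. The s-th
    powers keep the exponent 2 + 2/s within the integers. *)
Lemma blocks_enumeration (s : nat) : (0 < s)%N ->
    (forall k, s * m k.+1 <= s.+1 * m k)%N ->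
  exists b : nat -> nat,
    [/\ {homo b : i j / (i < j)%N}, forall j, blocks (polyN iota (b j))
      & exists C, forall j, (b j ^ s <= C ^ s * j.+1 ^ (s.+1).*2)%N].
Proof.
move=> s_gt0 m_slow; have q_gt1 : (1 < #|F|)%N by exact: card_finNzRing_gt1.
have le_m k : (k <= m k)%N.
  by elim: k => // k IHk; exact: leq_ltn_trans IHk (m_mono (ltnSn k)).
have ex_k j : exists k, (j < #|F| ^ m k)%N.
  exists j; apply: leq_trans (ltn_expl j q_gt1) _.
  by rewrite leq_exp2l.
have [|b [b_mono b_blocks b_lt]] :=
  @nat_enumeration (fun a => `[< blocks (polyN iota a) >]).
  move=> j; have [k ltj] := ex_k j.
  by exists (#|F| ^ (m k).*2.+1)%N; exact: leq_trans ltj (count_blocks k).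
exists b; split=> // [j|]; first exact/asboolP/b_blocks.
(* This constant bounds b_j itself when k = 0, and is at least q, as needed when k > 0. *)
exists (#|F| ^ (m 0).*2.+1)%N => j.
case: (ex_minnP (ex_k j)) => k ltj k_min.
have {}b_lt := b_lt j _ (leq_trans ltj (count_blocks k)).
case: k => [|k] in ltj k_min b_lt *.
  by rewrite -[leqLHS]muln1 leq_mul ?expn_gt0 // leq_exp2r // ltnW.
have le_j : (#|F| ^ m k <= j.+1)%N.
  by apply: leqW; rewrite leqNgt; apply/negP => /k_min; rewrite ltnn.
have le_C : (#|F| <= #|F| ^ (m 0).*2.+1)%N.
  by rewrite -[leqLHS]expn1 leq_exp2l.
apply: (@leq_trans (#|F| ^ s * (#|F| ^ m k) ^ (s.+1).*2)%N); last first.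
  by rewrite leq_mul // leq_exp2r.
apply: (@leq_trans ((#|F| ^ (m k.+1).*2.+1) ^ s)%N).
  by rewrite leq_exp2r // ltnW.
rewrite -!expnM -expnD leq_exp2l // mulSn mulnC.
by have := m_slow k; rewrite -!muln2; nia.
Qed.

End Iota.
End Construction.

Unset Implicit Arguments.
Set Strict Implicit.

(* b j is the index written b_(j+1) when the subsequence is numbered from 1. *)
Theorem theorem3p3 (R : realType) (F : finFieldType) (iota : 'I_#|F| -> F)
    (iota_bij : bijective iota)
    (iota0 : iota (Ordinal (card_finField_gt0 F)) = 0)
    (eps : R) (eps_gt0 : 0 < eps) :
  exists (b : nat -> nat) (K0' : nat),
    [/\ {homo b : i j / (i < j)%N},
        (0 < K0')%N,
        forall N : nat, (tN iota (range (fun j => polyN iota (b j))) N < K0')%N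
      & exists C : R, forall j : nat,
          (b j)%:R <= C * (j.+1)%:R `^ (2 + eps)].
Proof.
(* With s >= 2 / eps the exponent 2 + 2/s is at most 2 + eps; the successor makes s positive. *)
pose s := (Num.bound (2 / eps)).+1.
have le_s : 2 <= eps * s%:R.
  rewrite mulrC -ler_pdivrMr //.
  have /ltW/le_trans-> // : 2 / eps < (Num.bound (2 / eps))%:R.
    by apply: archi_boundP; rewrite divr_ge0 // ltW.
  by rewrite ler_nat.
have [L [m [M [size_M m_mono m_slow m_double M_coprime]]]] :=
  @coprime_moduli F s isT.
have [b [b_mono b_blocks [C le_b]]] :=
  blocks_enumeration size_M m_mono iota_bij iota0 (ltn0Sn _) m_slow.
exists b, (#|{: bool * 'I_L.+1}|).+1; split=> // [N|].
  rewrite ltnS; apply: (tN_blocks_le size_M) => //.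
  by move=> _ [j _ <-]; exact: b_blocks.
exists C%:R => j; set x := j.+1%:R : R.
have x_ge1 : 1 <= x by rewrite ler1n.
(* Taking s-th powers reduces the claim to the integer estimate and 2 (s + 1) <= (2 + eps) s. *)
rewrite -(@ler_pXn2r _ s) ?nnegrE ?mulr_ge0 ?powR_ge0 //.
have := le_b j; rewrite -(ler_nat R) natrM !natrX => /le_trans; apply.
rewrite exprMn ler_wpM2l ?exprn_ge0 //.
rewrite -[leRHS]powR_mulrn ?powR_ge0 // -powRrM -powR_mulrn ?(le_trans ler01) //.
apply: ler_powR => //.
by rewrite -/s -mul2n natrM -(@natr1 _ s) mulrDr mulr1 [leRHS]mulrDl lerD2l.
Qed.
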